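(* Let $\pi$ be the canonical map from $\mathfrak{B}(\mathfrak{H})$ onto the Calkin algebra on $\mathfrak{H}$. Then the image $\pi(\mathcal{H}(q))$ of $\mathcal{H}(q)$ in the Calkin algebra is isomorphic, as an associative algebra over $\mathbb{C}$, to the algebra $\mathbb{C}[x,x^{-1}]$ of complex Laurent polynomials in one indeterminate, and the integral powers $\pi(B)^i$ ($i\in\mathbb{Z}$) of the image of $B$ form a basis of $\pi(\mathcal{H}(q))$.
   Context: Fix a real number $q$ with $0<q<1$. Let $\mathbb{N}=\{0,1,2,\ldots\}$ and $\{n\}_q:=1+q+\cdots+q^{n-1}=\frac{1-q^n}{1-q}$ (so $\{0\}_q=0$). Let $\mathfrak{H}$ be an infinite-dimensional separable complex Hilbert space with a complete orthonormal basis $\{\Phi_n : n\in\mathbb{N}\}$, and let $\mathfrak{B}(\mathfrak{H})$ be the algebra of bounded linear operators on $\mathfrak{H}$. Let $A,B\in\mathfrak{B}(\mathfrak{H})$ be the bounded operators determined by $B\Phi_n=\sqrt{\{n+1\}_q}\,\Phi_{n+1}$ for $n\ge 0$, $A\Phi_n=\sqrt{\{n\}_q}\,\Phi_{n-1}$ for $n\geq 1$, and $A\Phi_0=0$. They satisfy $AB-qBA=I$. Let $\mathcal{H}(q)$ denote the unital subalgebra of $\mathfrak{B}(\mathfrak{H})$ generated by $A,B$ (no topological closure is taken; it is a faithful copy of the abstract $q$-deformed Heisenberg algebra generated by $A,B$ subject to $AB-qBA=I$). The Calkin algebra on $\mathfrak{H}$ is the quotient of $\mathfrak{B}(\mathfrak{H})$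 by the ideal of all compact operators. *)

(* Defs.v *)
From HB Require Import structures.
From mathcomp Require Import all_boot all_order all_algebra.
From mathcomp Require Import complex.
From mathcomp Require Import all_classical all_reals all_analysis.

Set Implicit Arguments.
Unset Strict Implicit.
Unset Printing Implicit Defensive.

Import Order.TTheory GRing.Theory Num.Theory.
Import numFieldNormedType.Exports.

Local Open Scope classical_set_scope.
Local Open Scope ring_scope.
Local Open Scope complex_scope.
Local Open Scope quotient_scope.

Definition lspan (K : pzRingType) (V : lmodType K) (I : Type) (e : I -> V) :
    set V :=
  [set v | exists (J : seq I) (a : I -> K), v = \sum_(i <- J) a i *: e i].

Definition lin_indep (K : pzRingType) (V : lmodType K) (I : eqType)
    (e : I -> V) :=
  forall (J : seq I) (a : I -> K), uniq J ->
    \sum_(i <- J) a i *: e i = 0 -> forall i, i \in J -> a i = 0.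

Definition is_basis (K : pzRingType) (V : lmodType K) (I : eqType) (S : set V)
    (e : I -> V) :=
  lin_indep e /\ lspan e = S.

(* GRing.subalg_closed requires the subalgebra to contain 1. *)
Definition gen_subalg (K : pzRingType) (A : lalgType K) (G : set A) : set A :=
  smallest (fun S : set A => GRing.subalg_closed (mem S)) G.

(* [hdot] is linear in its first argument and conjugate-linear in the second. *)

HB.mixin Record isHilbert (R : realType) H
    & CompleteNormedModule (R[i] : numFieldType) H := {
  hdot : {dot H for (@Num.conj R[i])};
  hdot_norm : forall x : H, hdot x x = `|x| ^+ 2
}.

#[short(type="hilbertType")]
HB.structure Definition Hilbert (R : realType) :=
  { H of CompleteNormedModule (R[i] : numFieldType) H & isHilbert R H }.

Definition complete_orthonormal (R : realType) (H : hilbertType R)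
    (Phi : nat -> H) :=
  (forall m n, hdot (Phi m) (Phi n) = (m == n)%:R) /\
  closure (lspan Phi) = [set: H].

(* Infinite-dimensional separable Hilbert spaces: those with a complete
   orthonormal basis indexed by the natural numbers. *)
HB.mixin Record hasCompleteOrthonormal (R : realType) H & Hilbert R H := {
  complete_orthonormal_ex : exists Phi : nat -> H, complete_orthonormal Phi
}.

#[short(type="sepHilbertType")]
HB.structure Definition SepHilbert (R : realType) :=
  { H of Hilbert R H & hasCompleteOrthonormal R H }.

Section BoundedOperators.
Variables (R : realType) (H : sepHilbertType R).
Local Notation C := (R[i]).

Record bop := Bop {
  bop_fun :> H -> H;
  bop_linear : linear bop_fun;
  bop_bounded : exists M : R, forall x, `|bop_fun x| <= M%:C * `|x|
}.

HB.instance Definition _ := gen_eqMixin bop.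
HB.instance Definition _ := gen_choiceMixin bop.
HB.instance Definition _ (T : bop) :=
  GRing.isLinear.Build C H H *:%R T (bop_linear T).

Lemma bopP (S T : bop) : (forall x, S x = T x) -> S = T.
Proof.
case: S T => [f lf bf] [g lg bg] /= /funext fg; subst g.
by congr Bop; exact: Prop_irrelevance.
Qed.

Lemma bop_bounded_pos (T : bop) :
  exists2 M : C, 0 < M & forall x, `|T x| <= M * `|x|.
Proof.
have [M TM] := bop_bounded T; exists (`|M| + 1)%:C.
  by rewrite ltcR ltr_pwDr.
move=> x; apply: (le_trans (TM x)); rewrite ler_wpM2r// lecR.
by apply: (le_trans (ler_norm M)); rewrite lerDl.
Qed.

Lemma bop_boundedW (f : H -> H) :
  (exists M : C, forall x, `|f x| <= M * `|x|) ->
  exists M : R, forall x, `|f x| <= M%:C * `|x|.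
Proof.
move=> [M fM]; exists (complex.Re M) => x.
have [->|x0] := eqVneq x 0; first by have := fM 0; rewrite normr0 !mulr0.
suff -> : (complex.Re M)%:C = M by exact: fM.
have x0' : 0 < `|x| by rewrite normr_gt0.
have : 0 <= M by rewrite -(pmulr_lge0 M x0') (le_trans _ (fM x)).
by case: M {fM} => a b; rewrite lecE /= => /andP[/eqP -> _].
Qed.

Fact bop0_linear : linear (fun _ : H => 0 : H).
Proof. by move=> a x y; rewrite scaler0 addr0. Qed.
Fact bop0_bounded : exists M : R, forall x : H, `|0 : H| <= M%:C * `|x|.
Proof. by exists 0 => x; rewrite normr0 mul0r. Qed.
Definition bop0 := Bop bop0_linear bop0_bounded.

Fact bop1_linear : linear (fun x : H => x). Proof. by []. Qed.
Fact bop1_bounded : exists M : R, forall x : H, `|x| <= M%:C * `|x|.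
Proof. by exists 1 => x; rewrite mul1r. Qed.
Definition bop1 := Bop bop1_linear bop1_bounded.

Fact bopN_linear (T : bop) : linear (fun x => - T x).
Proof. by move=> a x y; rewrite linearP opprD scalerN. Qed.
Fact bopN_bounded (T : bop) :
  exists M : R, forall x : H, `|- T x| <= M%:C * `|x|.
Proof.
by have [M TM] := bop_bounded T; exists M => x; rewrite normrN.
Qed.
Definition bopN (T : bop) := Bop (bopN_linear T) (bopN_bounded T).

Fact bopD_linear (S T : bop) : linear (fun x => S x + T x).
Proof. by move=> a x y; rewrite !linearP scalerDr addrACA. Qed.
Fact bopD_bounded (S T : bop) :
  exists M : R, forall x : H, `|S x + T x| <= M%:C * `|x|.
Proof.
have [M _ SM] := bop_bounded_pos S; have [N _ TN] := bop_bounded_pos T.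
apply: bop_boundedW; exists (M + N) => x.
by rewrite mulrDl (le_trans (ler_normD _ _))// lerD.
Qed.
Definition bopD (S T : bop) := Bop (bopD_linear S T) (bopD_bounded S T).

Fact bopZ_linear (a : C) (T : bop) : linear (fun x => a *: T x).
Proof. by move=> b x y; rewrite linearP scalerDr !scalerA mulrC. Qed.
Fact bopZ_bounded (a : C) (T : bop) :
  exists M : R, forall x : H, `|a *: T x| <= M%:C * `|x|.
Proof.
have [M _ TM] := bop_bounded_pos T.
apply: bop_boundedW; exists (`|a| * M) => x.
by rewrite normrZ -mulrA ler_wpM2l.
Qed.
Definition bopZ (a : C) (T : bop) := Bop (bopZ_linear a T) (bopZ_bounded a T).

Fact bopM_linear (S T : bop) : linear (fun x => S (T x)).
Proof. by move=> a x y; rewrite !linearP. Qed.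
Fact bopM_bounded (S T : bop) :
  exists M : R, forall x : H, `|S (T x)| <= M%:C * `|x|.
Proof.
have [M M0 SM] := bop_bounded_pos S; have [N _ TN] := bop_bounded_pos T.
apply: bop_boundedW; exists (M * N) => x.
by rewrite (le_trans (SM _))// -mulrA ler_wpM2l// ltW.
Qed.
Definition bopM (S T : bop) := Bop (bopM_linear S T) (bopM_bounded S T).

Fact bop_addA : associative bopD.
Proof. by move=> S T U; apply: bopP => x /=; rewrite addrA. Qed.
Fact bop_addC : commutative bopD.
Proof. by move=> S T; apply: bopP => x /=; rewrite addrC. Qed.
Fact bop_add0 : left_id bop0 bopD.
Proof. by move=> S; apply: bopP => x /=; rewrite add0r. Qed.
Fact bop_addN : left_inverse bop0 bopN bopD.
Proof. by move=> S; apply: bopP => x /=; rewrite addNr. Qed.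

HB.instance Definition _ :=
  GRing.isZmodule.Build bop bop_addA bop_addC bop_add0 bop_addN.

Fact bop_mulA : associative bopM.
Proof. by move=> S T U; apply: bopP. Qed.
Fact bop_mul1 : left_id bop1 bopM.
Proof. by move=> S; apply: bopP. Qed.
Fact bop_mulr1 : right_id bop1 bopM.
Proof. by move=> S; apply: bopP. Qed.
Fact bop_mulDl : left_distributive bopM bopD.
Proof. by move=> S T U; apply: bopP. Qed.
Fact bop_mulDr : right_distributive bopM bopD.
Proof. by move=> S T U; apply: bopP => x /=; rewrite linearD. Qed.
Fact bop_1neq0 : bop1 != bop0.
Proof.
apply/eqP => /(congr1 bop_fun) e10.
have [Phi [Phi1 _]] := @complete_orthonormal_ex R H.
have /= := congr1 (@^~ (Phi 0%N)) e10 => Phi0.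
by have := Phi1 0%N 0%N; rewrite Phi0 hdot_norm normr0 expr0n/= => /eqP;
  rewrite eq_sym oner_eq0.
Qed.

HB.instance Definition _ := GRing.Zmodule_isNzRing.Build bop
  bop_mulA bop_mul1 bop_mulr1 bop_mulDl bop_mulDr bop_1neq0.

Fact bop_scaleA (a b : C) (T : bop) : bopZ a (bopZ b T) = bopZ (a * b) T.
Proof. by apply: bopP => x /=; rewrite scalerA. Qed.
Fact bop_scale1 : left_id 1 bopZ.
Proof. by move=> T; apply: bopP => x /=; rewrite scale1r. Qed.
Fact bop_scaleDr : right_distributive bopZ +%R.
Proof. by move=> a S T; apply: bopP => x /=; rewrite scalerDr. Qed.
Fact bop_scaleDl (T : bop) : {morph bopZ^~ T : a b / a + b}.
Proof. by move=> a b; apply: bopP => x /=; rewrite scalerDl. Qed.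

HB.instance Definition _ := GRing.Zmodule_isLmodule.Build C bop
  bop_scaleA bop_scale1 bop_scaleDr bop_scaleDl.

Fact bop_scaleAl (a : C) (S T : bop) : a *: (S * T) = (a *: S) * T.
Proof. exact: bopP. Qed.
HB.instance Definition _ := GRing.Lmodule_isLalgebra.Build C bop bop_scaleAl.
Fact bop_scaleAr (a : C) (S T : bop) : a *: (S * T) = S * (a *: T).
Proof. by apply: bopP => x /=; rewrite linearZ. Qed.
HB.instance Definition _ := GRing.Lalgebra_isAlgebra.Build C bop bop_scaleAr.

Definition compact_op (T : bop) := precompact (T @` [set x : H | `|x| <= 1]).

Lemma bop_continuous (T : bop) : continuous T.
Proof.
apply: bounded_linear_continuous; apply/linear_boundedP.
have [M M0 TM] := bop_bounded_pos T.
near=> r => x; rewrite (le_trans (TM x))// ler_wpM2r//.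
by near: r; apply: nbhs_pinfty_ge; exact: gtr0_real.
Unshelve. all: by end_near. Qed.

Lemma compact_op_sub (K : set H) (T : bop) :
  compact K -> (forall x, `|x| <= 1 -> K (T x)) -> compact_op T.
Proof.
move=> cK TK; exists K => [y [x x1 <-]|]; first exact: TK.
by split => //; apply: compact_closed => //; exact: norm_hausdorff.
Qed.

Lemma compact_opE (T : bop) : compact_op T ->
  exists2 K : set H, compact K & forall x, `|x| <= 1 -> K (T x).
Proof. by move=> [K TK [cK _]]; exists K => // x x1; apply: TK; exists x. Qed.

Lemma compact_op0 : compact_op 0.
Proof.
by apply: (@compact_op_sub [set 0 : H]) => //; exact: compact_set1.
Qed.

Lemma compact_opMl (S T : bop) : compact_op T -> compact_op (S * T).
Proof.
move=> /compact_opE[K cK TK]; apply: (@compact_op_sub (S @` K)).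
  apply: continuous_compact => //; apply: continuous_subspaceT.
  exact: bop_continuous.
by move=> x x1; exists (T x) => //; exact: TK.
Qed.

Lemma compact_opZ (a : C) (T : bop) : compact_op T -> compact_op (a *: T).
Proof.
move=> cT; have -> : a *: T = (a *: 1) * T by rewrite -scalerAl mul1r.
exact: compact_opMl.
Qed.

Lemma compact_opN (T : bop) : compact_op T -> compact_op (- T).
Proof. by rewrite -scaleN1r; exact: compact_opZ. Qed.

Lemma compact_opMr (S T : bop) : compact_op S -> compact_op (S * T).
Proof.
move=> cS; have [M M0 TM] := bop_bounded_pos T.
have -> : S * T = M *: (S * (M^-1 *: T)).
  by rewrite -scalerAr scalerA divff ?scale1r// gt_eqF.
apply: compact_opZ.
have [K cK SK] := compact_opE cS.
apply: (@compact_op_sub K) => // x x1; apply: SK => /=.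
rewrite normrZ normfV gtr0_norm// ler_pdivrMl// mulr1 (le_trans (TM x))//.
by rewrite ler_piMr// ltW.
Qed.

Lemma compact_opD (S T : bop) :
  compact_op S -> compact_op T -> compact_op (S + T).
Proof.
move=> /compact_opE[K cK SK] /compact_opE[L cL TL].
apply: (@compact_op_sub ((fun z : H * H => z.1 + z.2) @` (K `*` L))).
  apply: continuous_compact; last exact: compact_setX.
  by apply: continuous_subspaceT; exact: add_continuous.
by move=> x x1; exists (S x, T x) => //; split; [exact: SK|exact: TL].
Qed.

Lemma compact_op1N : ~ compact_op 1.
Proof.
move=> /compact_opE[K cK HK].
have [Phi [Phi_on _]] := @complete_orthonormal_ex R H.
have Phi1 n : `|Phi n| = 1.
  apply/eqP; rewrite -(@eqrXn2 _ 2)// ?ler01// expr1n -hdot_norm.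
  by rewrite Phi_on eqxx.
have PhiK n : K (Phi n) by apply: HK; rewrite Phi1.
have Phi_dist m n : m != n -> 1 <= `|Phi m - Phi n|.
  move=> /negbTE mn; rewrite -(@ler_pXn2r _ 2)// ?nnegrE ?ler01//.
  rewrite expr1n -hdot_norm linearBl/= !linearB/= !Phi_on !eqxx [n == m]eq_sym mn.
  by rewrite mulr0n mulr1n subr0 oppr0 sub0r opprK lerDl ler01.
have [|x [_ clx]] := cK (Phi @ \oo) _.
  by exists 0%N => // n _; exact: PhiK.
have half_gt0 : (0 : C) < 2^-1 by rewrite invr_gt0 ltr0n.
have near_x N : exists2 n, (N <= n)%N & `|x - Phi n| < 2^-1.
  have tailN : (Phi @ \oo) [set Phi n | n in [set n | (N <= n)%N]].
    by exists N => // n /= Nn; exists n.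
  have [_ [[n /= Nn <-]]] := clx _ _ tailN (nbhsx_ballx x _ half_gt0).
  by rewrite -ball_normE /=; exists n.
have [m _ xm] := near_x 0%N; have [n mn xn] := near_x m.+1.
have /Phi_dist : m != n by rewrite ltn_eqF.
move=> /le_lt_trans d1; suff /d1 : `|Phi m - Phi n| < 1 by rewrite ltxx.
rewrite (_ : Phi m - Phi n = (x - Phi n) - (x - Phi m)); last first.
  by rewrite opprB [RHS]addrC addrA subrK.
rewrite (le_lt_trans (ler_normB _ _))// (splitr 1) mul1r.
exact: ltrD.
Qed.

End BoundedOperators.

Notation "''B' ( H )" := (bop H) (at level 8, format "''B' ( H )").

Section CalkinAlgebra.
Variables (R : realType) (H : sepHilbertType R).
Local Notation C := (R[i]).
Implicit Types S T : bop H.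

Definition calkin_rel S T := `[< compact_op (S - T) >].

Fact calkin_rel_equiv : equiv_class_of calkin_rel.
Proof.
split=> [S|S T|S T U].
- by apply/asboolP; rewrite subrr; exact: compact_op0.
- by apply/idP/idP => /asboolP/compact_opN; rewrite opprB => ?; apply/asboolP.
- move=> /asboolP TS /asboolP SU; apply/asboolP.
  by rewrite -(subrKA S); exact: compact_opD.
Qed.
Canonical calkin_equiv := EquivRelPack calkin_rel_equiv.

Definition calkin := {eq_quot calkin_equiv}.
HB.instance Definition _ := Choice.on calkin.
HB.instance Definition _ := EqQuotient.on calkin.

Definition calkin_pi (T : bop H) : calkin := \pi_calkin T.

Lemma calkin_piP S T : calkin_pi S = calkin_pi T <-> compact_op (S - T).
Proof.
by split=> [/eqmodP/asboolP //|ST]; apply/eqmodP/asboolP.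
Qed.

Lemma calkin_piK (x : calkin) : calkin_pi (repr x) = x.
Proof. exact: reprK. Qed.

Lemma calkin_ind (P : calkin -> Prop) :
  (forall T, P (calkin_pi T)) -> forall x, P x.
Proof. by move=> PT x; rewrite -(calkin_piK x). Qed.

Lemma calkin_repr T : compact_op (repr (calkin_pi T) - T).
Proof. by apply/calkin_piP; rewrite calkin_piK. Qed.

Definition calkin0 := calkin_pi 0.
Definition calkin1 := calkin_pi 1.
Definition calkinN (x : calkin) := calkin_pi (- repr x).
Definition calkinD (x y : calkin) := calkin_pi (repr x + repr y).
Definition calkinM (x y : calkin) := calkin_pi (repr x * repr y).
Definition calkinZ (a : C) (x : calkin) := calkin_pi (a *: repr x).

Lemma calkin_piN T : calkinN (calkin_pi T) = calkin_pi (- T).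
Proof.
apply/calkin_piP; rewrite opprK addrC -opprB.
by apply: compact_opN; exact: calkin_repr.
Qed.

Lemma calkin_piD S T :
  calkinD (calkin_pi S) (calkin_pi T) = calkin_pi (S + T).
Proof.
apply/calkin_piP; rewrite opprD addrACA.
by apply: compact_opD; exact: calkin_repr.
Qed.

Lemma calkin_piM S T :
  calkinM (calkin_pi S) (calkin_pi T) = calkin_pi (S * T).
Proof.
apply/calkin_piP; set S' := repr _; set T' := repr _.
have -> : S' * T' - S * T = S' * (T' - T) + (S' - S) * T.
  by rewrite mulrBr mulrBl addrA subrK.
apply: compact_opD; first by apply: compact_opMl; exact: calkin_repr.
by apply: compact_opMr; exact: calkin_repr.
Qed.

Lemma calkin_piZ a T : calkinZ a (calkin_pi T) = calkin_pi (a *: T).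
Proof.
apply/calkin_piP; rewrite -scalerBr.
by apply: compact_opZ; exact: calkin_repr.
Qed.

Let piE := (calkin_piN, calkin_piD, calkin_piM, calkin_piZ).

Fact calkin_addA : associative calkinD.
Proof.
by elim/calkin_ind=> S; elim/calkin_ind=> T; elim/calkin_ind=> U;
  rewrite !piE addrA.
Qed.
Fact calkin_addC : commutative calkinD.
Proof.
by elim/calkin_ind=> S; elim/calkin_ind=> T; rewrite !piE addrC.
Qed.
Fact calkin_add0 : left_id calkin0 calkinD.
Proof. by elim/calkin_ind=> S; rewrite !piE add0r. Qed.
Fact calkin_addN : left_inverse calkin0 calkinN calkinD.
Proof. by elim/calkin_ind=> S; rewrite !piE addNr. Qed.
HB.instance Definition _ := GRing.isZmodule.Build calkin
  calkin_addA calkin_addC calkin_add0 calkin_addN.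

Fact calkin_mulA : associative calkinM.
Proof.
by elim/calkin_ind=> S; elim/calkin_ind=> T; elim/calkin_ind=> U;
  rewrite !piE mulrA.
Qed.
Fact calkin_mul1 : left_id calkin1 calkinM.
Proof. by elim/calkin_ind=> S; rewrite !piE mul1r. Qed.
Fact calkin_mulr1 : right_id calkin1 calkinM.
Proof. by elim/calkin_ind=> S; rewrite !piE mulr1. Qed.
Fact calkin_mulDl : left_distributive calkinM calkinD.
Proof.
by elim/calkin_ind=> S; elim/calkin_ind=> T; elim/calkin_ind=> U;
  rewrite !piE mulrDl.
Qed.
Fact calkin_mulDr : right_distributive calkinM calkinD.
Proof.
by elim/calkin_ind=> S; elim/calkin_ind=> T; elim/calkin_ind=> U;
  rewrite !piE mulrDr.
Qed.
Fact calkin_1neq0 : calkin1 != calkin0.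
Proof.
apply/eqP => /calkin_piP; rewrite subr0; exact: compact_op1N.
Qed.
HB.instance Definition _ := GRing.Zmodule_isNzRing.Build calkin
  calkin_mulA calkin_mul1 calkin_mulr1 calkin_mulDl calkin_mulDr calkin_1neq0.

Fact calkin_scaleA (a b : C) (x : calkin) :
  calkinZ a (calkinZ b x) = calkinZ (a * b) x.
Proof. by elim/calkin_ind: x => T; rewrite !piE scalerA. Qed.
Fact calkin_scale1 : left_id 1 calkinZ.
Proof. by elim/calkin_ind=> T; rewrite !piE scale1r. Qed.
Fact calkin_scaleDr : right_distributive calkinZ +%R.
Proof.
move=> a; elim/calkin_ind=> S; elim/calkin_ind=> T.
by rewrite /GRing.add/= !piE scalerDr.
Qed.
Fact calkin_scaleDl (x : calkin) : {morph calkinZ^~ x : a b / a + b}.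
Proof.
elim/calkin_ind: x => T a b.
rewrite -[LHS]/(calkinZ _ _) -[RHS]/(calkinD (calkinZ _ _) (calkinZ _ _)).
by rewrite !piE scalerDl.
Qed.
HB.instance Definition _ := GRing.Zmodule_isLmodule.Build C calkin
  calkin_scaleA calkin_scale1 calkin_scaleDr calkin_scaleDl.

Fact calkin_scaleAl (a : C) (x y : calkin) : a *: (x * y) = (a *: x) * y.
Proof.
rewrite -[LHS]/(calkinZ _ (calkinM _ _)) -[RHS]/(calkinM (calkinZ _ _) _).
by elim/calkin_ind: x => S; elim/calkin_ind: y => T; rewrite !piE scalerAl.
Qed.
HB.instance Definition _ :=
  GRing.Lmodule_isLalgebra.Build C calkin calkin_scaleAl.
Fact calkin_scaleAr (a : C) (x y : calkin) : a *: (x * y) = x * (a *: y).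
Proof.
rewrite -[LHS]/(calkinZ _ (calkinM _ _)) -[RHS]/(calkinM _ (calkinZ _ _)).
by elim/calkin_ind: x => S; elim/calkin_ind: y => T; rewrite !piE scalerAr.
Qed.
HB.instance Definition _ :=
  GRing.Lalgebra_isAlgebra.Build C calkin calkin_scaleAr.

Fact calkin_pi_linear : linear calkin_pi.
Proof.
move=> a S T; rewrite -[RHS]/(calkinD (calkinZ _ _) _).
by rewrite !piE.
Qed.
HB.instance Definition _ :=
  GRing.isLinear.Build C (bop H) calkin *:%R calkin_pi calkin_pi_linear.
Fact calkin_pi_monoid_morphism : monoid_morphism calkin_pi.
Proof.
by split=> [//|S T]; rewrite -[RHS]/(calkinM _ _) !piE.
Qed.
HB.instance Definition _ :=
  GRing.isMonoidMorphism.Build (bop H) calkin calkin_pi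
    calkin_pi_monoid_morphism.

(* Two-sided inverses, chosen classically; non-units are their own inverse, as
   required by unitRingType. *)
Definition calkin_unit : pred calkin :=
  fun x => `[< exists y, y * x = 1 /\ x * y = 1 >].
Definition calkin_inv (x : calkin) : calkin :=
  if pselect (exists y, y * x = 1 /\ x * y = 1) is left h
  then sval (cid h) else x.

Fact calkin_mulVx : {in calkin_unit, left_inverse 1 calkin_inv *%R}.
Proof.
move=> x /asboolP ux; rewrite /calkin_inv; case: pselect => // h.
by case: (cid h) => y [].
Qed.
Fact calkin_mulxV : {in calkin_unit, right_inverse 1 calkin_inv *%R}.
Proof.
move=> x /asboolP ux; rewrite /calkin_inv; case: pselect => // h.
by case: (cid h) => y [].
Qed.
Fact calkin_unitP (x y : calkin) : y * x = 1 /\ x * y = 1 -> calkin_unit x.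
Proof. by move=> yx; apply/asboolP; exists y. Qed.
Fact calkin_inv_out : {in [predC calkin_unit], calkin_inv =1 id}.
Proof.
move=> x /asboolP ux; rewrite /calkin_inv; by case: pselect.
Qed.
HB.instance Definition _ := GRing.NzRing_hasMulInverse.Build calkin
  calkin_mulVx calkin_mulxV calkin_unitP calkin_inv_out.

End CalkinAlgebra.

(* F[x, x^-1], as the localisation of F[x] at the powers of x inside F(x) *)
Section LaurentPolynomials.
Variable F : fieldType.
Local Notation "p %:F" := (@FracField.tofrac {poly F} p).

Definition laurent_pred : pred {fraction {poly F}} :=
  fun f => `[< exists (p : {poly F}) (n : nat), f = p%:F / 'X%:F ^+ n >].

Lemma tofracX_neq0 : ('X : {poly F})%:F != 0.
Proof. by rewrite tofrac_eq0 polyX_eq0. Qed.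

Lemma laurent_poly (p : {poly F}) : p%:F \in laurent_pred.
Proof. by apply/asboolP; exists p, 0%N; rewrite expr0 divr1. Qed.

Fact laurent_subring_closed : subring_closed laurent_pred.
Proof.
have X0 n : 'X%:F ^+ n != 0 :> {fraction {poly F}}.
  by rewrite expf_neq0// tofracX_neq0.
split.
- by rewrite -(tofrac1 {poly F}) laurent_poly.
- move=> _ _ /asboolP[p [m ->]] /asboolP[r [n ->]]; apply/asboolP.
  exists (p * 'X ^+ n - r * 'X ^+ m), (m + n)%N.
  rewrite tofracB !tofracM !tofracXn exprD invfM.
  rewrite mulrBl; congr (_ - _).
    by rewrite mulrACA (divff (X0 n)) mulr1.
  by rewrite (mulrC ('X%:F ^- m)) mulrACA (divff (X0 m)) mulr1.
- move=> _ _ /asboolP[p [m ->]] /asboolP[r [n ->]]; apply/asboolP.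
  by exists (p * r), (m + n)%N; rewrite tofracM exprD invfM mulrACA.
Qed.
HB.instance Definition _ :=
  GRing.isSubringClosed.Build _ laurent_pred laurent_subring_closed.

Definition laurent := {f : {fraction {poly F}} | f \in laurent_pred}.
HB.instance Definition _ := [isSub of laurent for sval].
HB.instance Definition _ := [Choice of laurent by <:].
HB.instance Definition _ := [SubChoice_isSubComNzRing of laurent by <:].

Definition laurent_of_poly (p : {poly F}) : laurent := Sub p%:F (laurent_poly p).
Definition laurentZ (a : F) (f : laurent) : laurent := laurent_of_poly a%:P * f.

Fact laurent_scaleA (a b : F) (f : laurent) :
  laurentZ a (laurentZ b f) = laurentZ (a * b) f.
Proof. by apply: val_inj; rewrite /= !rmorphM/= mulrA. Qed.
Fact laurent_scale1 : left_id 1 laurentZ.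
Proof. by move=> f; apply: val_inj; rewrite /= !rmorph1 mul1r. Qed.
Fact laurent_scaleDr : right_distributive laurentZ +%R.
Proof. by move=> a f g; rewrite /laurentZ mulrDr. Qed.
Fact laurent_scaleDl (f : laurent) : {morph laurentZ^~ f : a b / a + b}.
Proof. by move=> a b; apply: val_inj; rewrite /= !rmorphD/= mulrDl. Qed.
HB.instance Definition _ := GRing.Zmodule_isLmodule.Build F laurent
  laurent_scaleA laurent_scale1 laurent_scaleDr laurent_scaleDl.

Fact laurent_scaleAl (a : F) (f g : laurent) : a *: (f * g) = (a *: f) * g.
Proof. exact: mulrA. Qed.
HB.instance Definition _ :=
  GRing.Lmodule_isLalgebra.Build F laurent laurent_scaleAl.
HB.instance Definition _ := GRing.Lalgebra_isComAlgebra.Build F laurent.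

End LaurentPolynomials.

Definition qint (R : pzSemiRingType) (q : R) (n : nat) : R :=
  \sum_(i < n) q ^+ i.

(* Main.v *)
(* On the basis vectors, (1 - q) A B - 1 and B ((1 - q) A) - 1 are diagonal with
   entries - q^(n+1) and - q^n tending to 0, hence compact. So (1 - q) pi(A) is
   the inverse of pi(B), and pi(H(q)) is the image of the evaluation map
   x |-> pi(B) on Laurent polynomials, i.e. the span of the powers of pi(B).
   For linear independence, multiply a relation by pi(B)^(-i): it lifts to a
   compact operator S with <S Phi_n, Phi_n> equal to the coefficient of pi(B)^i
   for all n, and the diagonal entries of a compact operator tend to 0. *)

Require Import Defs.
From HB Require Import structures.
From mathcomp Require Import all_boot all_order all_algebra.
From mathcomp Require Import finmap complex.
From mathcomp Require Import ring.
From mathcomp Require Import all_classical all_reals all_analysis.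

Set Implicit Arguments.
Unset Strict Implicit.
Unset Printing Implicit Defensive.

Import Order.TTheory GRing.Theory Num.Theory.
Import numFieldNormedType.Exports.

Local Open Scope classical_set_scope.
Local Open Scope ring_scope.
Local Open Scope complex_scope.

(** * Compactness by total boundedness *)

Lemma ultra_bigcup (T : Type) (I : choiceType) (D : {fset I}) (f : I -> set T)
    (F : set_system T) : UltraFilter F -> F (cover [set` D] f) ->
  exists2 i, i \in D & F (f i).
Proof.
move=> FU FD; apply: contrapT => nF.
have FC i : i \in D -> F (~` f i).
  move=> iD; case: (in_ultra_setVsetC (f i) FU) => // Ffi.
  by exfalso; apply: nF; exists i.
have [x [[i iD fix_] /(_ i iD)]] := filter_ex (filterI FD (filter_bigI _ FC)).
exact.
Qed.

Section Compactness.
Variables (R : realType) (H : sepHilbertType R).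
Local Notation C := (R[i]).
Implicit Types (T : bop H) (x y : H).

(* The image of the unit ball is totally bounded, so every ultrafilter
   containing its closure is Cauchy. *)
Lemma compact_op_approx T :
  (forall e : C, 0 < e -> exists2 K : set H, compact K &
     forall x, `|x| <= 1 -> exists2 y, K y & `|T x - y| < e) ->
  compact_op T.
Proof.
move=> Tapx; rewrite /compact_op precompactE compact_ultra => F FU Fcl.
suff Fc : cauchy F.
  have /cauchy_cvgP Fcv := Fc.
  exists (lim F); split => //.
  apply: closed_closure => B /Fcv FB; exact: filter_ex (filterI Fcl FB).
apply: cauchy_exP => e e0.
(* Three errors of [e / 3] add up: a point [z] of the ultrafilter's set is near some [T x], which is
   near some [k] in [K], which is near one of finitely many centres [y]. *)
have e3 : 0 < e / 3 by rewrite divr_gt0.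
have [K cK TK] := Tapx _ e3.
move: cK; rewrite compact_cover => cK.
have [||D _ KD] := cK H K (fun y => ball y (e / 3)).
- by move=> y _; exact: ball_open.
- by move=> y Ky; exists y => //; exact: ballxx.
have [|y _ Fy] := @ultra_bigcup _ _ D (fun y => ball y e) F FU; last first.
  by exists y.
apply: filterS Fcl => z /(_ _ (nbhsx_ballx z _ e3))[_ [[x x1 <-] zTx]].
have [k Kk Txk] := TK x x1; have [y yD yk] := KD _ Kk.
exists y => //; move: zTx yk Txk.
rewrite -!ball_normE /= => zTx yk Txk.
have -> : y - z = (y - k) - (T x - k) - (z - T x).
  by rewrite !opprB [y - k + _]addrA subrK addrA subrK.
have -> : e = e / 3 + e / 3 + e / 3 by field.
apply: le_lt_trans (ler_normB _ _) _; apply: ltrD => //.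
by apply: le_lt_trans (ler_normB _ _) _; exact: ltrD.
Qed.

(** * Compact sets of linear combinations with bounded coefficients *)

Lemma real_scale_continuous x : continuous (fun a : R => a%:C *: x).
Proof.
move=> a; apply/cvgrPdist_lt => e e0.
have [->|x0] := eqVneq x 0.
  by near=> b; rewrite !scaler0 subrr normr0.
have : 0 < e / `|x| by rewrite divr_gt0// normr_gt0.
(* A positive element of [R[i]] has zero imaginary part, so the estimate becomes one between real
   numbers. *)
case ed : (e / `|x|) => [d d']; rewrite ltcE /= => /andP[/eqP d'0 d0].
near=> b; rewrite -scalerBl -rmorphB normrZ normc_def /= expr0n addr0 sqrtr_sqr.
rewrite -ltr_pdivlMr ?normr_gt0// ed d'0 ltcR.
by near: b; apply: cvgr_dist_lt => //; exact: cvg_id.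
Unshelve. all: by end_near. Qed.

Lemma compact_add (K L : set H) :
  compact K -> compact L -> compact [set x + y | x in K & y in L].
Proof.
move=> cK cL.
have -> : [set x + y | x in K & y in L] =
    (fun z : H * H => z.1 + z.2) @` (K `*` L).
  apply/seteqP; split=> [_ [x Kx [y Ly <-]]|_ [[x y] [Kx Ly] <-]].
    by exists (x, y).
  by exists x => //; exists y.
apply: continuous_compact; last exact: compact_setX.
by apply: continuous_subspaceT; exact: add_continuous.
Qed.

(** The disc of scalars lies in a square: the real and imaginary parts range over [[-r, r]], and the
    sum of two continuous images of this real segment is compact. *)
Lemma disc_compact (r : R) x :
  exists2 D : set H, compact D & forall z : C, `|z| <= r%:C -> D (z *: x).
Proof.
pose I y : set H := (fun a : R => a%:C *: y) @` `[- r, r].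
have cI y : compact (I y).
  apply: continuous_compact; last exact: segment_compact.
  by apply: continuous_subspaceT; exact: real_scale_continuous.
exists [set y + z | y in I x & z in I ('i%C *: x)]; first exact: compact_add.
move=> z zr.
have zI (a : R) : `|a%:C| <= `|z| -> [set` `[- r, r]] a.
  move=> /le_trans/(_ zr); rewrite normc_def /= expr0n addr0 sqrtr_sqr lecR.
  by rewrite /= in_itv /= -ler_norml.
have Ez : z = (complex.Re z)%:C + (complex.Im z)%:C * 'i%C.
  by rewrite {1}[z]complexE mulrC.
exists ((complex.Re z)%:C *: x).
  exists (complex.Re z) => //; apply: zI.
  by rewrite !normc_def lecR /= ler_wsqrtr// expr0n lerD// sqr_ge0.
exists ((complex.Im z)%:C *: ('i%C *: x)).
  exists (complex.Im z) => //; apply: zI.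
  by rewrite !normc_def lecR /= ler_wsqrtr// expr0n /= addr0 lerDr sqr_ge0.
by rewrite scalerA -scalerDl -Ez.
Qed.

Lemma polydisc_compact (r : R) (v : nat -> H) N :
  exists2 K : set H, compact K & forall c : nat -> C,
    (forall n, `|c n| <= r%:C) -> K (\sum_(n < N) c n *: v n).
Proof.
elim: N => [|N [K cK KN]].
  exists [set 0]; first exact: compact_set1.
  by move=> c _; rewrite big_ord0.
have [D cD DN] := disc_compact r (v N).
exists [set x + y | x in K & y in D]; first exact: compact_add.
move=> c cr; rewrite big_ord_recr /=.
by eexists; [exact: KN|eexists; [exact: DN|]].
Qed.

(** * Finite orthonormal expansions *)

Lemma hdotZl a x y : hdot (a *: x) y = a * hdot x y.
Proof. by rewrite linearZl_LR. Qed.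

Section Orthonormal.
Variable Phi : nat -> H.
Hypothesis hPhi : forall m n, hdot (Phi m) (Phi n) = (m == n)%:R.

Lemma norm_orthonormal n : `|Phi n| ^+ 2 = 1.
Proof. by rewrite -hdot_norm hPhi eqxx. Qed.

Lemma hdot_sum M (c : nat -> C) m :
  hdot (\sum_(n < M) c n *: Phi n) (Phi m) = if (m < M)%N then c m else 0.
Proof.
rewrite linear_sumlz /=; under eq_bigr do rewrite hdotZl hPhi.
case: ltnP => mM.
  rewrite (bigD1 (Ordinal mM))//= eqxx mulr1 big1 ?addr0// => i.
  by rewrite -val_eqE /= => /negbTE ->; rewrite mulr0.
by rewrite big1// => i _; rewrite ltn_eqF ?mulr0// (leq_trans _ mM).
Qed.

Lemma hnorm_sum M (c : nat -> C) :
  `|\sum_(n < M) c n *: Phi n| ^+ 2 = \sum_(n < M) `|c n| ^+ 2.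
Proof.
elim: M => [|M IH]; first by rewrite !big_ord0 normr0 expr0n.
rewrite !big_ord_recr /= -IH -hdot_norm hnormDd.
  by rewrite /= !hdot_norm normrZ exprMn norm_orthonormal mulr1.
apply/eqP; rewrite herm_eq0C /= hdotZl linear_sumr /= big1 ?mulr0// => i _.
by rewrite linearZr_LR /= hPhi gtn_eqF// mulr0.
Qed.

(** By Pythagoras: [x] is the sum of its component along [Phi m] and a remainder orthogonal to
    it. *)
Lemma norm_hdot_le x m : `|hdot x (Phi m)| <= `|x|.
Proof.
set a := hdot _ _; have ax : hdot (x - a *: Phi m) (a *: Phi m) = 0.
  by rewrite linearZr_LR /= linearBl/= hdotZl hPhi eqxx mulr1 subrr mulr0.
have := hnormDd ax; rewrite subrK /= !hdot_norm normrZ exprMn.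
rewrite norm_orthonormal mulr1 => xE.
by rewrite -(@ler_pXn2r _ 2)// ?nnegrE// xE lerDr exprn_ge0.
Qed.

(** Repeated indices are merged into one coefficient, and coefficients beyond [M] vanish. The length
    [N] stays free so that sums can later be lengthened and split at will. *)
Lemma lspan_sum z : lspan Phi z ->
  exists (c : nat -> C) M,
    forall N, (M <= N)%N -> z = \sum_(n < N) c n *: Phi n.
Proof.
move=> [J [a ->]].
exists (fun n => \sum_(i <- J | i == n) a i), (\max_(i <- J) i).+1 => N JN.
under [RHS]eq_bigr do rewrite scaler_suml big_mkcond.
rewrite exchange_big /= big_seq [RHS]big_seq; apply: eq_bigr => i iJ.
have iN : (i < N)%N by apply: leq_trans JN; rewrite ltnS leq_bigmax_seq.
rewrite (bigD1 (Ordinal iN))//= eqxx big1 ?addr0// => j.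
by rewrite -val_eqE eq_sym /= => /negbTE ->.
Qed.
End Orthonormal.

(** * Compactness and diagonal entries *)

Section Basis.
Variable Phi : nat -> H.
Hypothesis hPhi : complete_orthonormal Phi.

(** The truncation of [T] to the first [N] basis vectors maps the ball into a compact polydisc, and
    the tail is at most [sup |t n|] in norm. Both are computed on a finite combination [z] close to
    [x]. *)
Lemma compact_op_diag T (t : nat -> C) :
  (forall n, T (Phi n) = t n *: Phi n) ->
  (forall e : C, 0 < e -> exists N, forall n, (N <= n)%N -> `|t n| <= e) ->
  compact_op T.
Proof.
move: hPhi => [on dense] TPhi t0; apply: compact_op_approx => e e0.
have e4 : 0 < e / 4 by rewrite divr_gt0.
have [N tN] := t0 _ e4.
(* The radius 2 serves every [x] of the unit ball: [z] is taken within 1 of [x], so its coefficients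
   are bounded by [|z| <= 2]. *)
have [K cK KN] := polydisc_compact 2 (fun n => t n *: Phi n) N.
exists K => // x x1.
have [M M0 TM] := bop_bounded_pos T.
have : closure (lspan Phi) x by rewrite dense.
have eM : 0 < e / 4 / M by rewrite divr_gt0.
move=> /(_ _ (filterI (nbhsx_ballx x _ ltr01) (nbhsx_ballx x _ eM))).
move=> [z [/lspan_sum[c [L cL]]]]; rewrite -!ball_normE /= => -[xz1 xzM].
have z2 : `|z| <= 2.
  rewrite -[z](subKr x) (le_trans (ler_normB _ _))//.
  by rewrite [leRHS](_ : _ = 1 + 1 :> C)// lerD// ltW.
(* With [N + L] terms the expansion of [z] can be split at [N]. *)
have zE := cL _ (leq_addl N L).
have c2 n : `|c n| <= 2.
  rewrite (le_trans _ z2)// (cL (n.+1 + L)%N (leq_addl _ _)).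
  rewrite (_ : c n = hdot (\sum_(i < n.+1 + L) c i *: Phi i) (Phi n)).
    exact: norm_hdot_le.
  by rewrite hdot_sum// ltn_addr.
exists (\sum_(n < N) c n *: (t n *: Phi n)).
  by apply: KN => n; rewrite (_ : 2%:C = 2) ?c2// rmorphMn.
have Tz : `|T z - \sum_(n < N) c n *: (t n *: Phi n)| <= e / 4 * 2.
  have -> : T z - \sum_(n < N) c n *: (t n *: Phi n) =
      \sum_(n < L) (c (N + n)%N * t (N + n)%N) *: Phi (N + n)%N.
    apply/eqP; rewrite subr_eq addrC {1}zE linear_sum big_split_ord /=.
    by apply/eqP; congr (_ + _); apply: eq_bigr => i _;
      rewrite linearZ /= TPhi ?scalerA.
  apply: le_trans (_ : e / 4 * `|z| <= _); last by rewrite ler_wpM2l// ltW.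
  rewrite -(@ler_pXn2r _ 2)// ?nnegrE// ?(mulr_ge0 (ltW e4) (normr_ge0 z))//.
  have onN m n : hdot (Phi (N + m)%N) (Phi (N + n)%N) = (m == n)%:R.
    by rewrite on eqn_add2l.
  rewrite (hnorm_sum onN L (fun n => c (N + n)%N * t (N + n)%N)).
  rewrite exprMn {1}zE hnorm_sum// big_split_ord /= mulrDr.
  apply: ler_wpDl; first by rewrite mulr_ge0 ?exprn_ge0 ?sumr_ge0// ?(ltW e4).
  rewrite mulr_sumr ler_sum// => i _.
  rewrite normrM exprMn mulrC ler_wpM2r// ?exprn_ge0//.
  by rewrite lerXn2r ?nnegrE ?(ltW e4)// tN// leq_addr.
rewrite -(subrKA (T z)) -linearB.
apply: le_lt_trans (ler_normD _ _) _.
(* One quarter bounds [T x - T z], two bound the tail because [|z| <= 2], and one is to spare. *)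
have -> : e = e / 4 + e / 4 * 2 + e / 4 by field.
apply: ltr_wpDr; first exact: ltW.
apply: ltr_leD => //; apply: le_lt_trans (TM _) _.
by rewrite mulrC -ltr_pdivlMr.
Qed.

(** The vectors [T (Phi n)] cluster at some [y], which is approximated by a finite combination [z].
    For large [n], [z] is orthogonal to [Phi n], so [|a| <= |T (Phi n) - z|], and this is less than
    [|a|] if [a] is nonzero. *)
Lemma compact_op_diag_const T a :
  compact_op T -> (forall n, hdot (T (Phi n)) (Phi n) = a) -> a = 0.
Proof.
move: hPhi => [on dense] /compact_opE[K cK TK] Ta.
apply/eqP; apply: contraT => a0.
have a2 : 0 < `|a| / 2 by rewrite divr_gt0 ?normr_gt0.
have [|y [_ cly]] := cK ((T \o Phi) @ \oo) _.
  exists 0%N => // n _; apply: TK.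
  by rewrite -(@ler_pXn2r _ 2)// ?nnegrE ?ler01// -hdot_norm on eqxx expr1n.
have : closure (lspan Phi) y by rewrite dense.
move=> /(_ _ (nbhsx_ballx y _ a2))[z [/lspan_sum[c [M cM]]]].
rewrite -ball_normE /= => yz.
have tail : ((T \o Phi) @ \oo) [set T (Phi n) | n in [set n | (M <= n)%N]].
  by exists M => // n /= Mn; exists n.
have [_ [[n /= Mn <-]]] := cly _ _ tail (nbhsx_ballx y _ a2).
rewrite -ball_normE /= => yT.
have az : hdot (T (Phi n) - z) (Phi n) = a.
  by rewrite linearBl /= Ta (cM M)// hdot_sum// ltnNge Mn subr0.
have := norm_hdot_le on (T (Phi n) - z) n; rewrite az => aT.
have := le_lt_trans aT; move=> /(_ `|a|); rewrite ltxx; apply.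
rewrite -(subrKA y) (splitr `|a|) (le_lt_trans (ler_normD _ _))// ltrD//.
by rewrite distrC.
Qed.
End Basis.

End Compactness.

(** * Evaluation of Laurent polynomials at a unit *)

Lemma horner_alg_sum (F : nzRingType) (E : algType F) (b : E) (p : {poly F}) :
  horner_alg b p = \sum_(i < size p) p`_i *: b ^+ i.
Proof.
rewrite -{1}[p]coefK poly_def linear_sum; apply: eq_bigr => i _.
by rewrite linearZ /= mulr_algl rmorphXn /= horner_algX.
Qed.

Section LaurentEvaluation.
Variables (F : fieldType) (E : unitAlgType F) (b : E).
Local Notation "p %:F" := (@FracField.tofrac {poly F} p).

Lemma laurent_repr (f : laurent F) :
  {pn : {poly F} * nat | val f * 'X%:F ^+ pn.2 = pn.1%:F}.
Proof.
apply: cid; have /asboolP[p [n fE]] := valP f; exists (p, n).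
by rewrite fE divfK// expf_neq0// tofracX_neq0.
Qed.

(* The proof that [b] is a unit is an argument so that the morphism instances
   below can find it. *)
Definition laurent_eval of b \is a GRing.unit := fun f : laurent F =>
  let pn := sval (laurent_repr f) in horner_alg b pn.1 * b ^- pn.2.

(** [E] may be noncommutative; multiplicativity of the evaluation needs denominators to move past
    numerators. *)
Lemma comm_horner_alg (p : {poly F}) n :
  GRing.comm (horner_alg b p) (b ^- n).
Proof.
apply: commrV; apply: commrX.
by rewrite /GRing.comm -{2 3}(horner_algX b) -!rmorphM mulrC.
Qed.

Hypothesis ub : b \is a GRing.unit.

(** The value is independent of the chosen fraction: cross-multiplying gives an identity of
    polynomials, which is evaluated at [b] and divided by powers of the unit [b]. *)
Lemma laurent_evalE (f : laurent F) p n :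
  val f * 'X%:F ^+ n = p%:F -> laurent_eval ub f = horner_alg b p * b ^- n.
Proof.
rewrite /laurent_eval; case: laurent_repr => -[r m] /= fr fp.
have : r * 'X^n = p * 'X^m.
  apply/eqP; rewrite -tofrac_eq !tofracM !tofracXn -fr -fp.
  by rewrite mulrAC.
move=> /(congr1 (horner_alg b)); rewrite !rmorphM !rmorphXn /= !horner_algX.
move=> rp; apply: (mulIr (unitrX n ub)); rewrite divrK ?unitrX//.
apply: (mulIr (unitrX m ub)); rewrite -rp -!mulrA; congr (_ * _).
by rewrite -exprD addnC exprD mulKr ?unitrX.
Qed.

Fact laurent_eval_linear : linear (laurent_eval ub).
Proof.
move=> a f g; have [[p m] /= fp] := laurent_repr f.
have [[r n] /= gr] := laurent_repr g.
rewrite (laurent_evalE fp) (laurent_evalE gr).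
rewrite (@laurent_evalE _ (a *: p * 'X^n + r * 'X^m) (m + n)%N); last first.
  rewrite /= -mul_polyC !tofracD !tofracM !tofracXn -fp -gr exprD; ring.
have bK k : b ^+ k * b ^- k = 1 by rewrite divrr// unitrX.
rewrite rmorphD !rmorphM !rmorphXn /= !horner_algX linearZ /= mulrDl.
rewrite -!mulrA -(exprVn _ (m + n)) {1}addnC !exprD !exprVn.
by rewrite !(mulrA (b ^+ _)) !bK !mul1r mulr_algl.
Qed.

Fact laurent_eval_monoid_morphism : monoid_morphism (laurent_eval ub).
Proof.
split=> [|f g].
  by rewrite (@laurent_evalE _ 1 0%N) ?rmorph1 ?mul1r ?invr1 //= mulr1.
have [[p m] /= fp] := laurent_repr f; have [[r n] /= gr] := laurent_repr g.
rewrite (laurent_evalE fp) (laurent_evalE gr).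
rewrite (@laurent_evalE _ (p * r) (m + n)%N); last first.
  by rewrite /= tofracM -fp -gr exprD; ring.
rewrite rmorphM -[b ^- (m + n)]exprVn exprD !exprVn -!mulrA; congr (_ * _).
by rewrite !mulrA comm_horner_alg.
Qed.

HB.instance Definition _ :=
  GRing.isLinear.Build F (laurent F) E *:%R (laurent_eval ub)
    laurent_eval_linear.
HB.instance Definition _ :=
  GRing.isMonoidMorphism.Build (laurent F) E (laurent_eval ub)
    laurent_eval_monoid_morphism.

End LaurentEvaluation.

(** * Generated subalgebras and q-integers *)

Lemma gen_subalg_closed (K : pzRingType) (A : lalgType K) (G : set A) :
  GRing.subalg_closed (mem (gen_subalg G)).
Proof.
split=> [|a u v|u v].
- by apply/mem_set => S [[/set_mem S1 _ _] _].
- move=> /set_mem uG /set_mem vG; apply/mem_set => S [[S1 SL SM] GS].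
  by apply/set_mem/SL; apply/mem_set; [apply: uG|apply: vG].
- move=> /set_mem uG /set_mem vG; apply/mem_set => S [[S1 SL SM] GS].
  by apply/set_mem/SM; apply/mem_set; [apply: uG|apply: vG].
Qed.

Lemma qintE (R : pzRingType) (q : R) n : (1 - q) * qint q n = 1 - q ^+ n.
Proof. by rewrite -opprB -[RHS]opprB subrX1 mulNr. Qed.

Lemma qint_ge0 (R : numDomainType) (q : R) n : 0 <= q -> 0 <= qint q n.
Proof. by move=> q0; apply: sumr_ge0 => i _; rewrite exprn_ge0. Qed.

(** * The q-oscillator modulo compact operators *)

Section QOscillator.
Variables (R : realType) (q : R) (hq0 : 0 < q) (hq1 : q < 1).
Variables (H : sepHilbertType R) (Phi : nat -> H).
Variables (hPhi : complete_orthonormal Phi) (A B : bop H).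
Hypotheses
  (hB : forall n, B (Phi n) = (Num.sqrt (qint q n.+1))%:C *: Phi n.+1)
  (hA : forall n, (1 <= n)%N ->
    A (Phi n) = (Num.sqrt (qint q n))%:C *: Phi n.-1)
  (hA0 : A (Phi 0%N) = 0).
Local Notation C := (R[i]).
Local Notation b := (calkin_pi B).

Definition lowering : bop H := (1 - q)%:C *: A.

Lemma geometric_small (e : C) : 0 < e ->
  exists N, forall n, (N <= n)%N -> `|(- q ^+ n)%:C| <= e.
Proof.
case: e => e e'; rewrite ltcE /= => /andP[/eqP -> e0].
have /cvgr0Pnorm_le/(_ _ e0)[N _ qN] : (fun n => q ^+ n) @ \oo --> (0 : R).
  by apply: cvg_expr; rewrite ger0_norm// ltW.
exists N => n /qN /=.
by rewrite normc_def /= expr0n addr0 sqrtr_sqr lecR normrN.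
Qed.

Lemma qint_sqrt n :
  (1 - q)%:C * (Num.sqrt (qint q n))%:C * (Num.sqrt (qint q n))%:C =
  (1 - q ^+ n)%:C.
Proof.
by rewrite -!rmorphM -mulrA -expr2 sqr_sqrtr ?qintE// qint_ge0// ltW.
Qed.

Lemma loweringB : calkin_pi lowering * b = 1.
Proof.
rewrite -rmorphM -(rmorph1 (@calkin_pi R H)); apply/calkin_piP.
apply: (compact_op_diag hPhi (t := fun n => (- q ^+ n.+1)%:C)) => [n|e e0].
  rewrite /= hB linearZ /= hA// !scalerA qint_sqrt.
  by rewrite -[X in _ - X]scale1r -scalerBl -rmorphB addrC addKr.
have [N qN] := geometric_small e0; exists N => n Nn; apply: qN.
exact: leq_trans Nn _.
Qed.

Lemma Blowering : b * calkin_pi lowering = 1.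
Proof.
rewrite -rmorphM -(rmorph1 (@calkin_pi R H)); apply/calkin_piP.
apply: (compact_op_diag hPhi (t := fun n => (- q ^+ n)%:C)) => [[|n]|e e0].
(* [A] kills [Phi 0], so the entry there is -1, which is [- q ^+ 0]. *)
- by rewrite /= hA0 scaler0 linear0 sub0r expr0 rmorphN scaleN1r.
- rewrite /= hA// linearZ linearZ /= hB !scalerA qint_sqrt.
  by rewrite -[X in _ - X]scale1r -scalerBl -rmorphB addrC addKr.
- exact: geometric_small.
Qed.

Lemma calkinB_unit : b \is a GRing.unit.
Proof.
apply/unitrP; exists (calkin_pi lowering).
by split; [exact: loweringB|exact: Blowering].
Qed.

Lemma calkinB_inv : b^-1 = calkin_pi lowering.
Proof.
by apply: (mulIr calkinB_unit); rewrite mulVr ?calkinB_unit// loweringB.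
Qed.

(** A lift of the [i]-th power of [b] that stays inside the algebra generated by [A] and [B]. *)
Definition shift (i : int) : bop H :=
  match i with Posz n => B ^+ n | Negz n => lowering ^+ n.+1 end.

Lemma calkin_shift i : calkin_pi (shift i) = b ^ i.
Proof.
case: i => n; rewrite /= rmorphXn//= -calkinB_inv.
by rewrite exprVn.
Qed.

(** [shift i] sends [Phi n] to a multiple of [Phi (n + i)], or to 0 when that index would be
    negative. *)
Lemma shift_diag i n : hdot (shift i (Phi n)) (Phi n) = (i == 0)%:R.
Proof.
case: i => [[|k]|k] /=; first by rewrite hPhi.1 eqxx.
  have [c ->] : exists c : C, (B ^+ k.+1) (Phi n) = c *: Phi (k.+1 + n)%N.
    elim: k.+1 => [|m [c IH]]; first by exists 1; rewrite scale1r.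
    by rewrite exprS /= IH linearZ /= hB scalerA; eexists.
  by rewrite hdotZl hPhi.1 gtn_eqF ?mulr0// addSn ltnS leq_addl.
(* [Phi 0] is treated apart: there the truncated index [0 - k.+1] would be 0 again and orthogonality
   would say nothing. *)
case: n => [|n].
  by rewrite exprSr /= hA0 scaler0 linear0 linear0l.
(* Truncated subtraction is harmless here: [c] is 0 once the index would drop below 0, and the index
   stays below [n.+1]. *)
have [c ->] : exists c : C,
    (lowering ^+ k.+1) (Phi n.+1) = c *: Phi (n.+1 - k.+1)%N.
  elim: k.+1 => [|m [c IH]]; first by exists 1; rewrite scale1r.
  rewrite exprS /= IH linearZ /= subnS; case: (n.+1 - m)%N => [|p].
    by exists 0; rewrite hA0 !scaler0 scale0r.
  by rewrite hA// !scalerA; eexists.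
by rewrite hdotZl hPhi.1 subSS ltn_eqF ?mulr0// ltnS leq_subr.
Qed.

Lemma calkinB_lin_indep : lin_indep (fun i : int => b ^ i).
Proof.
move=> J a uJ J0 i iJ; pose S : bop H := \sum_(j <- J) a j *: shift (j - i).
apply: (@compact_op_diag_const _ _ _ hPhi S) => [|n].
  rewrite -[S]subr0; apply/calkin_piP; rewrite !linear_sum linear0.
  under eq_bigr do
    rewrite linearZ /= calkin_shift exprzDr ?calkinB_unit// scalerAl.
  by rewrite -mulr_suml J0 mul0r.
have -> : S (Phi n) = \sum_(j <- J) a j *: shift (j - i) (Phi n).
  rewrite /S; elim: J {uJ J0 iJ S} => [|j J IH]; first by rewrite !big_nil.
  by rewrite !big_cons -IH.
rewrite linear_sumlz /=.
under eq_bigr do rewrite hdotZl shift_diag subr_eq0.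
rewrite (bigD1_seq i)//= eqxx mulr1 big1 ?addr0// => j /negbTE ->.
by rewrite mulr0.
Qed.

Local Notation ev := (laurent_eval calkinB_unit).
Local Notation Hq := (gen_subalg [set A; B]).
Local Notation piHq := [set calkin_pi T | T in Hq].

Lemma laurent_eval_inj : injective ev.
Proof.
apply/raddf_inj => f; have [[p n] /= fp] := laurent_repr f.
rewrite (laurent_evalE _ fp) => p0.
have {}p0 : horner_alg b p = 0.
  have ubn : b ^- n \is a GRing.unit by rewrite unitrV unitrX// calkinB_unit.
  by apply: (mulIr ubn); rewrite p0 mul0r.
suff p_eq0 : p = 0.
  apply: val_inj; apply: (mulIf (expf_neq0 n (tofracX_neq0 _))).
  by rewrite fp p_eq0 mul0r rmorph0.
apply/polyP => i; rewrite coef0; have [pi|ip] := leqP (size p) i.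
  exact: nth_default.
(* [p(b) = 0] is a relation among nonnegative powers, so [absz] recovers the coefficient index. *)
apply: (calkinB_lin_indep (J := [seq Posz k | k <- iota 0 (size p)])
    (a := fun j => p`_(absz j)) _ _ (i := Posz i)).
- by rewrite map_inj_uniq ?iota_uniq// => ? ? [].
- rewrite big_map -[RHS]p0 horner_alg_sum.
  by rewrite -(big_mkord predT (fun i => p`_i *: b ^+ i)) /index_iota subn0.
- by rewrite map_f// mem_iota.
Qed.

Lemma laurent_eval_lspan : range ev `<=` lspan (fun i : int => b ^ i).
Proof.
move=> _ [f _ <-]; have [[p n] /= fp] := laurent_repr f.
rewrite (laurent_evalE _ fp).
(* Dividing by [b ^+ n] shifts exponents by [-n]; adding [n] back to an exponent gives the index of
   its coefficient. *)
exists [seq i%:Z - n%:Z | i <- iota 0 (size p)],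
  (fun j => p`_(absz (j + n%:Z))).
rewrite big_map horner_alg_sum mulr_suml.
rewrite -(big_mkord predT (fun i => p`_i *: b ^+ i * b ^- n)).
rewrite /index_iota subn0; apply: eq_bigr => i _.
by rewrite subrK exprzDr ?calkinB_unit// -scalerAl exprnN.
Qed.

Lemma lspan_calkinHq : lspan (fun i : int => b ^ i) `<=` piHq.
Proof.
have [H1 HL HM] := gen_subalg_closed [set A; B].
(* Closure is stated for [a *: u + v] only, hence 0 is written as [-1 *: 1 + 1]. *)
have H0 : 0 \in Hq by rewrite -(subrr 1) -scaleN1r addrC HL.
have HX T n : T \in Hq -> T ^+ n \in Hq.
  by move=> TH; elim: n => [|n IH]; rewrite ?expr0// exprS HM.
have HG : [set A; B] `<=` Hq by move=> T TAB S [_]; exact.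
have lowH : lowering \in Hq.
  rewrite -[lowering]addr0; apply: HL => //; apply/mem_set.
  exact: HG A (or_introl erefl).
have BH : B \in Hq by exact: mem_set (HG B (or_intror erefl)).
move=> _ [J [a ->]]; exists (\sum_(i <- J) a i *: shift i).
  apply: set_mem; elim: J => [|i J IH]; rewrite ?big_nil// big_cons HL//.
  by case: i => k; exact: HX.
by rewrite linear_sum; apply: eq_bigr => i _; rewrite linearZ /= calkin_shift.
Qed.

(** The preimage of [range ev] under [calkin_pi] is a subalgebra. It contains [B], the lift of the
    image of [x], and [A], a multiple of [lowering], which lifts the image of the inverse of [x].
    Minimality of the generated subalgebra concludes. *)
Lemma calkinHq_laurent : piHq `<=` range ev.
Proof.
move=> _ [T TH <-]; apply: (TH [set T | range ev (calkin_pi T)]).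
have evX : ev (laurent_of_poly 'X) = b.
  by rewrite (@laurent_evalE _ _ _ _ _ 'X 0)//= ?mulr1// divr1 horner_algX.
split; first split=> [|a S U|S U].
- by apply/mem_set; exists 1 => //; rewrite !rmorph1.
- move=> /set_mem[f _ fS] /set_mem[g _ gU]; apply/mem_set.
  by exists (a *: f + g) => //; rewrite !linearP /= fS gU.
- move=> /set_mem[f _ fS] /set_mem[g _ gU]; apply/mem_set.
  by exists (f * g) => //; rewrite !rmorphM /= fS gU.
move=> _ [] ->; last by exists (laurent_of_poly 'X).
have XV : (FracField.tofrac 'X)^-1 \in @laurent_pred C.
  by apply/asboolP; exists 1, 1; rewrite rmorph1 expr1 mul1r.
have -> : A = ((1 - q)%:C)^-1 *: lowering.
  by rewrite scalerA mulVf ?scale1r// fmorph_eq0 subr_eq0 gt_eqF.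
pose Xinv : laurent C := Sub (FracField.tofrac 'X)^-1 XV.
exists (((1 - q)%:C)^-1 *: Xinv) => //.
rewrite [LHS]linearZ [RHS]linearZ /= -calkinB_inv; congr (_ *: _).
rewrite (@laurent_evalE _ _ _ _ _ 1 1%N)/= ?rmorph1 ?mul1r//.
by rewrite mulVf// tofracX_neq0.
Qed.

End QOscillator.

Theorem corollary3p12 (R : realType) (q : R) (hq0 : 0 < q) (hq1 : q < 1)
    (H : sepHilbertType R) (Phi : nat -> H) (hPhi : complete_orthonormal Phi)
    (A B : 'B(H))
    (hB : forall n, B (Phi n) = (Num.sqrt (qint q n.+1))%:C *: Phi n.+1)
    (hA : forall n, (1 <= n)%N ->
      A (Phi n) = (Num.sqrt (qint q n))%:C *: Phi n.-1)
    (hA0 : A (Phi 0%N) = 0) :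
  let Hq : set 'B(H) := gen_subalg [set A; B] in
  let piHq : set (calkin H) := [set calkin_pi T | T in Hq] in
  (exists f : {lrmorphism laurent R[i] -> calkin H},
     set_bij [set: laurent R[i]] piHq f) /\
  (calkin_pi B \is a GRing.unit /\
   is_basis piHq (fun i : int => calkin_pi B ^ i)).
Proof.
move=> Hq piHq; pose ev := laurent_eval (calkinB_unit hq0 hq1 hPhi hB hA hA0).
have ev_lspan := @laurent_eval_lspan R q hq0 hq1 H Phi hPhi A B hB hA hA0.
have lspan_Hq := @lspan_calkinHq R q hq0 hq1 H Phi hPhi A B hB hA hA0.
have Hq_ev := @calkinHq_laurent R q hq0 hq1 H Phi hPhi A B hB hA hA0.
(* The inclusions form a cycle, from [range ev] to the span of the powers to [piHq] and back, so the
   three sets coincide. *)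
split; last split.
- exists ev; split; [|move=> f g _ _|exact: Hq_ev].
    by move=> f _; apply/lspan_Hq/ev_lspan; exists f.
  exact: laurent_eval_inj.
- exact: (calkinB_unit hq0 hq1 hPhi hB hA hA0).
- split; first exact: (calkinB_lin_indep hq0 hq1 hPhi hB hA hA0).
  by apply/seteqP; split=> // x /Hq_ev/ev_lspan.
Qed.
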